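(* Let $\mathcal{G}$ be a compact group acting continuously on a sample space $\mathcal{Y}$, let $\mathbb{Q}$ be a probability measure on $\mathcal{Y}$ with group average $\overline{\mathbb{Q}}$, and let $\mathbb{Q} = \mathbb{Q}_a + \mathbb{Q}_s$ be the Lebesgue decomposition of $\mathbb{Q}$ with respect to $\overline{\mathbb{Q}}$ ($\mathbb{Q}_a$ absolutely continuous, $\mathbb{Q}_s$ singular). Consider the utility $U = \log$. Then a $U$-optimal e-value for $\mathcal{G}$ invariance against $\mathbb{Q}$ is $$\varepsilon^{\log}(y) = \frac{d\mathbb{Q}_a}{d\overline{\mathbb{Q}}}(y) \Big/ \mathbb{E}_{\overline{G}}\left[\frac{d\mathbb{Q}_a}{d\overline{\mathbb{Q}}}(\overline{G}y)\right]$$ on orbits with $\mathbb{E}_{\overline{G}}\big[\frac{d\mathbb{Q}_a}{d\overline{\mathbb{Q}}}(\overline{G}y)\big] > 0$, $\varepsilon^{\log} = 1$ on other orbits, and $\varepsilon^{\log}(y) = \infty$, $\mathbb{Q}_s$-a.s.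
   Context: All spaces are second-countable locally compact Hausdorff, equipped with their Borel $\sigma$-algebras. $\overline{G}$ follows the Haar probability measure on $\mathcal{G}$. The orbit of $y$ is $O_y = \{Gy : G \in \mathcal{G}\}$. The group average of $\mathbb{Q}$ is $\overline{\mathbb{Q}}(A) = \mathbb{E}_{\overline{G}}[\mathbb{Q}(\overline{G}^{-1}A)]$. A probability $\mathbb{P}$ is $\mathcal{G}$ invariant if $\mathbb{P}(G^{-1}A) = \mathbb{P}(A)$ for all $G \in \mathcal{G}$ and events $A$. A measurable $\varepsilon : \mathcal{Y} \to [0,\infty]$ is a valid e-value for $\mathcal{G}$ invariance if $\mathbb{E}^{\mathbb{P}}[\varepsilon] \leq 1$ for every $\mathcal{G}$ invariant probability $\mathbb{P}$. A valid e-value $\varepsilon^*$ is $U$-optimal against $\mathbb{Q}$ if $\mathbb{E}^{\mathbb{Q}_a}[U(\varepsilon^* )] \geq \mathbb{E}^{\mathbb{Q}_a}[U(\varepsilon)]$ for every e-value $\varepsilon$ valid for $\mathcal{G}$ invariance, imposing $\varepsilon=\infty$ $\mathbb{Q}_s$-a.s., and assuming that both sides are well-defined; here $\mathbb{E}^{\mathbb{Q}_a}$ denotes integration against the sub-probability $\mathbb{Q}_a$, and $\log 0 = -\infty$, $\log \infty = \infty$. *)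

(* Defs.v *)
From HB Require Import structures.
From mathcomp Require Import all_boot all_order all_algebra.
From mathcomp Require Import all_classical all_reals all_analysis.
From mathcomp Require Import measurable_realfun.

Set Implicit Arguments.
Unset Strict Implicit.
Unset Printing Implicit Defensive.

Import Order.TTheory GRing.Theory Num.Theory.

Local Open Scope classical_set_scope.
Local Open Scope ring_scope.
Local Open Scope ereal_scope.

HB.mixin Record isTopologicalGroup G
    of PointedTopological G & Group G := {
  mulg_continuous : continuous (fun p : G * G => (p.1 * p.2)%g);
  invg_continuous : continuous (fun g : G => g^-1%g) }.

#[short(type="topGroupType")]
HB.structure Definition TopologicalGroup :=
  { G of PointedTopological G & Group G & isTopologicalGroup G }.

(* A space with its Borel sigma-algebra. Library measurable types are pointed,
   hence the restriction to pointed (i.e. nonempty) spaces. *)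
Notation borel T := (g_sigma_algebraType (@open T)).

Definition second_countable_lch (T : topologicalType) : Prop :=
  [/\ @second_countable T, locally_compact [set: T] & hausdorff_space T].

Definition continuous_action (G : topGroupType) (Y : ptopologicalType)
    (act : G -> Y -> Y) : Prop :=
  [/\ forall y, act 1%g y = y,
      forall g h y, act (g * h)%g y = act g (act h y)
    & continuous (fun p : G * Y => act p.1 p.2)].

(* On a compact group the left Haar probability is also right invariant. *)
Definition is_haar (R : realType) (G : topGroupType)
    (haar : probability (borel G) R) : Prop :=
  forall (g : G) (A : set (borel G)), measurable A ->
    haar [set (g * h)%g | h in A] = haar A.

Section group_invariance.
Context (R : realType) (G : topGroupType) (Y : ptopologicalType).
Variables (haar : probability (borel G) R) (act : G -> Y -> Y).

Definition group_average (Q : set (borel Y) -> \bar R) (A : set (borel Y)) :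
    \bar R :=
  \int[haar]_g Q (act g^-1%g @` A).

Definition group_invariant (P : set (borel Y) -> \bar R) : Prop :=
  forall (g : G) (A : set (borel Y)), measurable A ->
    P (act g^-1%g @` A) = P A.

Definition valid_evalue (eps : borel Y -> \bar R) : Prop :=
  [/\ measurable_fun setT eps,
      forall y, 0 <= eps y
    & forall P : probability (borel Y) R,
        group_invariant P -> \int[P]_y eps y <= 1].

Definition singular (mu nu : set (borel Y) -> \bar R) : Prop :=
  exists B : set (borel Y), [/\ measurable B, mu (~` B) = 0 & nu B = 0].

Definition lebesgue_decomposition (Q Qa Qs nu : set (borel Y) -> \bar R) :
    Prop :=
  [/\ forall A : set (borel Y), measurable A -> Q A = Qa A + Qs A,
      Qa `<< nu
    & singular Qs nu].

(* f is an arbitrary [0, +oo]-valued version of d mu / d nu. The library's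
   Radon_Nikodym is one particular version, nonnegative only a.e., whereas the
   formula for the e-value is evaluated on every orbit. *)
Definition is_RN_derivative (mu nu : set (borel Y) -> \bar R)
    (f : borel Y -> \bar R) : Prop :=
  [/\ measurable_fun setT f,
      forall y, 0 <= f y
    & forall A : set (borel Y), measurable A ->
        mu A = \int[nu]_(y in A) f y].

(* The integral of f^+ minus that of f^- is not of the form oo - oo (which the
   library integral would evaluate to -oo). *)
Definition integral_defined (mu : set (borel Y) -> \bar R)
    (f : borel Y -> \bar R) : Prop :=
  (\int[mu]_y f^\+ y) +? (- \int[mu]_y f^\- y).

(* Requiring eps' = +oo Qs-a.e. of the competitors too would give the same
   notion: setting eps' to +oo on a set which carries Qs and is null under every
   invariant probability changes neither validity nor the Qa-integral. *)
Definition utility_optimal (U : \bar R -> \bar R)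
    (Qa Qs : {measure set (borel Y) -> \bar R}) (eps : borel Y -> \bar R) :
    Prop :=
  [/\ valid_evalue eps,
      {ae Qs, forall y, eps y = +oo}
    & forall eps' : borel Y -> \bar R,
        valid_evalue eps' ->
        integral_defined Qa (U \o eps) -> integral_defined Qa (U \o eps') ->
        \int[Qa]_y U (eps' y) <= \int[Qa]_y U (eps y)].

Definition orbit_mean (f : borel Y -> \bar R) (y : Y) : \bar R :=
  \int[haar]_g f (act g y).

(* orbit_mean f is constant on orbits, so the test below depends only on the
   orbit of y. If orbit_mean f y = +oo the quotient is 0, as (+oo)^-1 = 0. *)
Definition log_evalue (f : borel Y -> \bar R) (N : set (borel Y))
    (y : borel Y) : \bar R :=
  if y \in N then +oo
  else if 0 < orbit_mean f y then f y / orbit_mean f y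
  else 1.

(* A set where "+oo, Qs-a.s." can be realised: it carries Qs, and validity
   forces a set where an e-value is +oo to be null under every invariant
   probability. *)
Definition infinity_set (Qs : set (borel Y) -> \bar R) (N : set (borel Y)) :
    Prop :=
  [/\ measurable N,
      Qs (~` N) = 0
    & forall P : probability (borel Y) R, group_invariant P -> P N = 0].

End group_invariance.

(* Main.v *)
Require Import Defs.
From HB Require Import structures.
From mathcomp Require Import all_boot all_order all_algebra.
From mathcomp Require Import all_classical all_reals all_analysis.
From mathcomp Require Import measurable_realfun lra.

Set Implicit Arguments.
Unset Strict Implicit.
Unset Printing Implicit Defensive.

Import Order.TTheory GRing.Theory Num.Theory.

Local Open Scope classical_set_scope.
Local Open Scope ring_scope.
Local Open Scope ereal_scope.

(** Write [om h y] for the orbit mean of a nonnegative [h], the integral of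
    [h (g y)] over the Haar probability, and Qbar for the group average of Q.

    Everything reduces to orbit means. For an invariant probability P, Tonelli
    gives that [h] and [om h] have the same P-integral ([integral_orbit_mean]).
    Conversely the law of [g y], for [g] Haar distributed, is an invariant
    probability that integrates [h] to [om h y] ([orbit_law]). Hence an e-value
    is valid exactly when all its orbit means are at most 1 ([valid_evalueP]).
    Since [om] is constant on orbits, which rests on the right invariance of the
    Haar probability ([integral_haar_mulgr]), the quotient [f / om f] has orbit
    mean 1 where [om f] is positive and finite and 0 where it is infinite, so
    the proposed e-value [e] is valid ([valid_log_evalue]); its value +oo on [N]
    does no harm because [N] is null under every invariant probability.

    For optimality the key estimate is that every valid [e'] satisfies
    [\int[Qa] e' / e <= Qa setT] ([integral_ratio]). Indeed [Qa] has density [f]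
    with respect to Qbar, and [(e' / e) * f] is at most [e' * om f] Qbar-a.e.;
    averaging over orbits turns the integral of [e' * om f] into that of
    [om e' * om f], which is at most the integral of [om f], namely the mass of
    [Qa]. Then [lne e' - lne e <= e' / e - 1] is integrated
    ([le_log_integral]). Either logarithm may have an infinite integral, so
    this inequality is first rearranged into one between sums of nonnegative
    terms, whose integrals always exist.

    A set that realises the value +oo exists because, if B carries Qs and is
    Qbar-null, then almost every orbit, for Q, meets B in a Haar-null set of
    group elements; removing from B the other orbits leaves a set that is null
    for every invariant probability ([infinity_set_exists]). *)

(** * Measurability *)

Lemma measurable_lne (R : realType) : measurable_fun setT (@lne R).
Proof.
rewrite (_ : @lne R = fun x => if x \is a fin_num then
  (if (fine x <= 0)%R then -oo else (ln (fine x))%:E) else x); last first.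
  by apply/funext => -[].
apply: measurable_fun_ifT => //=.
  by apply: (measurable_fun_bool true); exact/emeasurable_fin_num.
apply: measurable_fun_ifT => //=.
  by apply: measurable_fun_ler => //; exact: measurable_cst.
by apply/measurable_EFinP; apply: measurableT_comp => //; exact: measurable_ln.
Qed.

Lemma measurable_invr (R : realType) : measurable_fun setT (@GRing.inv R).
Proof.
rewrite -(setvU [set 0%R : R]).
apply/measurable_funU; [exact: measurableC|by []|split];
  last exact: measurable_fun_set1.
apply: open_continuous_measurable_fun.
  by apply: closed_openC; exact: closed_eq.
by move=> x; rewrite inE => /eqP x0; exact: inv_continuous.
Qed.

Lemma measurable_inve (R : realType) : measurable_fun setT (@inve R).
Proof.
rewrite (_ : @inve R = fun x => if x \is a fin_num then
  (if fine x == 0%R then +oo else ((fine x)^-1)%:E)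
  else if x == +oo then 0 else -oo); last first.
  by apply/funext => -[].
apply: measurable_fun_ifT => //=.
- by apply: (measurable_fun_bool true); exact/emeasurable_fin_num.
- apply: measurable_fun_ifT => //=.
    by apply: measurable_fun_eqr => //; exact: measurable_cst.
  apply/measurable_EFinP.
  by apply: measurableT_comp => //; exact: measurable_invr.
- by apply: measurable_fun_ifT => //=; exact: measurable_fun_eqe.
Qed.

(** Second countability makes an open set of the product a countable union of
    rectangles of basic open sets, hence an element of the product of the two
    Borel sigma-algebras. *)
Lemma measurable_continuous_prod (X Z W : ptopologicalType)
    (F : X * Z -> W) :
  @second_countable X -> @second_countable Z -> continuous F ->
  measurable_fun setT (F : borel X * borel Z -> borel W).
Proof.
move=> [B cB [Bo Bn]] [C cC [Co Cn]] cF.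
apply: (@measurability _ _ (borel X * borel Z)%type (borel W) setT _ (@open W)).
  by [].
move=> _ [V oV <-].
rewrite setTI; set A := F @^-1` V.
have oA : open A by move/continuousP : cF; apply.
pose r (p : set X * set Z) : set (borel X * borel Z) := p.1 `*` p.2.
pose D := [set p | [/\ B p.1, C p.2 & r p `<=` A]].
have -> : A = \bigcup_(p : set_type D) r (val p).
  apply/seteqP; split => [[x z] Axz|xz [p _]]; last first.
    by have [_ _] := set_valP p; apply.
  have [[P Q]/= [/Bn [U [BU Ux] UP] /Cn [U' [CU U'z] UQ]] PQ] : nbhs (x, z) A.
    exact: open_nbhs_nbhs.
  have DU : D (U, U').
    by split => //= -[a b] [/= /UP Pa /UQ Qb]; exact: (PQ (a, b)).
  by exists (SigSub (mem_set DU)) => //; split.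
apply: countable_bigcupT_measurable => [|p].
  rewrite (eq_countable (card_setT _)); apply: sub_countable (countableX cB cC).
  by apply: subset_card_le => p [].
have [Bp Cp _] := set_valP p.
by apply: measurableX; apply: sub_sigma_algebra; [exact: Bo|exact: Co].
Qed.

Lemma measurable_continuous (X W : ptopologicalType) (F : X -> W) :
  continuous F -> measurable_fun setT (F : borel X -> borel W).
Proof.
move=> cF; apply: (@measurability _ _ (borel X) (borel W) setT _ (@open W)).
  by [].
move=> _ [V oV <-]; rewrite setTI; apply: sub_sigma_algebra.
by move/continuousP : cF; apply.
Qed.

(** * Densities and the tangent line of the logarithm *)

(** The density [f] may take the value +oo; it agrees almost everywhere with the
    finite Radon-Nikodym derivative, for which the formula is known. *)
Lemma ge0_integral_density d (T : measurableType d) (R : realType)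
    (mu : {measure set T -> \bar R})
    (nu : {sigma_finite_measure set T -> \bar R})
    (f h : T -> \bar R) :
  mu setT < +oo ->
  measurable_fun setT f -> (forall x, 0 <= f x) ->
  (forall A, measurable A -> mu A = \int[nu]_(x in A) f x) ->
  measurable_fun setT h -> (forall x, 0 <= h x) ->
  \int[mu]_x h x = \int[nu]_x (h x * f x).
Proof.
move=> muoo mf f0 muE mh h0.
pose m : {finite_measure set T -> \bar R} := mfrestr measurableT muoo.
have mE A : m A = mu A by rewrite /m /= /mfrestr /mrestr setIT.
have mnu : m `<< nu.
  apply/null_content_dominatesP => A mA nuA0.
  rewrite mE muE// null_set_integral//; exact: measurable_funTS.
transitivity (\int[m]_x h x).
  by apply: eq_measure_integral => A _ _; exact/esym/mE.
rewrite -(Radon_Nikodym_SigmaFinite.change_of_variables mnu)//.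
have mg : measurable_fun setT (Radon_Nikodym_SigmaFinite.f m nu).
  exact: measurable_int (Radon_Nikodym_SigmaFinite.f_integrable mnu).
apply: ge0_ae_eq_integral => //.
- exact: emeasurable_funM.
- exact: emeasurable_funM.
- by move=> x _; rewrite mule_ge0// Radon_Nikodym_SigmaFinite.f_ge0.
- by move=> x _; rewrite mule_ge0.
apply: ae_eqe_mul2l.
apply: integral_ae_eq => //.
  exact: (Radon_Nikodym_SigmaFinite.f_integrable mnu).
by move=> A _ mA; rewrite -Radon_Nikodym_SigmaFinite.f_integral// -muE// mE.
Qed.

(** The tangent inequality [lne x - lne y <= x / y - 1], with the negative terms
    moved across so that both sides make sense even if [lne x] is infinite. *)
Lemma lne_tangent (R : realType) (x y : \bar R) : 0 <= x -> 0 < y < +oo ->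
  maxe (lne x) 0 + maxe (- lne y) 0 + 1 <=
  maxe (lne y) 0 + maxe (- lne x) 0 + x / y.
Proof.
move=> x0 /andP[]; case: y => [y| |]//; rewrite lte_fin => y0 _.
have nny (z : \bar R) : maxe z 0 != -oo by rewrite -ltNye lt_max ltNy0 orbT.
have ny : lne y%:E = (ln y)%:E by rewrite lne_EFin.
rewrite inver gt_eqF//.
case: x x0 => [x| |]// x0; last first.
  rewrite gt0_mulye ?lte_fin ?invr_gt0// [leRHS]addey ?leey//.
  by rewrite adde_eq_ninfty negb_or !nny.
rewrite lee_fin in x0; move: x0; rewrite le_eqVlt => /predU1P[<-|x0].
  rewrite (@le0_lneNy _ 0)// [- -oo]/= maxye [X in _ <= X + _]addey//.
  by rewrite addye ?leey// mul0e.
rewrite ny lne_EFin// -!EFinN -!EFin_max -EFinM -!EFinD lee_fin.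
have : (ln (x / y) <= x / y - 1)%R.
  rewrite -[in leLHS](subrK 1%R (x / y)%R) addrC le_ln1Dx//.
  by rewrite ltrBDr addrC subrr divr_gt0.
rewrite lnM ?posrE ?invr_gt0// lnV ?posrE//.
by case: (leP (ln x) 0%R); case: (leP (- ln x)%R 0%R);
  case: (leP (ln y) 0%R); case: (leP (- ln y)%R 0%R); lra.
Qed.

Lemma law_probability d d' (T : measurableType d) (T' : measurableType d')
    (R : realType) (P : probability T R) (X : T -> T') :
  measurable_fun setT X ->
  exists P' : probability T' R,
    (forall A, P' A = P (X @^-1` A)) /\
    (forall h, measurable_fun setT h -> (forall y, 0 <= h y) ->
       \int[P']_y h y = \int[P]_x h (X x)).
Proof.
move=> mX; pose X' : {mfun T >-> T'} := mfun_Sub (mem_set mX).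
exists (distribution P X'); split => // h mh h0.
by rewrite ge0_integral_distribution.
Qed.

Lemma integral_indicT d (T : measurableType d) (R : realType)
    (mu : {measure set T -> \bar R}) (A : set T) :
  measurable A -> \int[mu]_x (\1_A x)%:E = mu A.
Proof. by move=> mA; rewrite integral_indic// setIT. Qed.

Lemma measurable_eindic d (T : measurableType d) (R : realType) (A : set T) :
  measurable A -> measurable_fun setT (fun x => (\1_A x)%:E : \bar R).
Proof. by move=> mA; apply/measurable_EFinP. Qed.

(** * Invariance of the Haar probability *)

Section haar.
Context (R : realType) (G : topGroupType) (haar : probability (borel G) R).
Hypotheses (G2 : @second_countable G) (haarP : is_haar haar).
Implicit Types F : borel G -> \bar R.

Lemma measurable_mulg :
  measurable_fun setT
    ((fun p : G * G => (p.1 * p.2)%g) : borel G * borel G -> borel G).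
Proof. exact: measurable_continuous_prod G2 G2 (@mulg_continuous G). Qed.

Lemma measurable_invg :
  measurable_fun setT ((fun g : G => g^-1%g) : borel G -> borel G).
Proof. exact: measurable_continuous (@invg_continuous G). Qed.

Lemma measurable_mulgl (k : G) :
  measurable_fun setT ((fun g : G => (k * g)%g) : borel G -> borel G).
Proof. exact: measurable_fun_pair2 _ measurable_mulg. Qed.

Lemma measurable_mulgr (k : G) :
  measurable_fun setT ((fun g : G => (g * k)%g) : borel G -> borel G).
Proof. exact: measurable_fun_pair1 _ measurable_mulg. Qed.

Lemma integral_haar_mulgl (k : G) F :
  measurable_fun setT F -> (forall g, 0 <= F g) ->
  \int[haar]_g F (k * (g : G))%g = \int[haar]_g F g.
Proof.
move=> mF F0; have [P [PE Pint]] := law_probability haar (measurable_mulgl k).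
rewrite -Pint//; apply: eq_measure_integral => A mA _.
rewrite [LHS]PE -[RHS](haarP k^-1%g mA); congr (haar _).
apply/seteqP; split => [g Ag|_ [g Ag <-]]; last by rewrite /preimage/= mulVKg.
by exists (k * (g : G))%g => //; rewrite mulKg.
Qed.

(** Integrate [F (h^-1 g)] over both [g] and [h]: left translation of [g] by
    [h^-1] removes [h], while left translation of [h] by [g] removes [g] and
    leaves [F (h^-1)]. *)
Lemma integral_haar_invg F :
  measurable_fun setT F -> (forall g, 0 <= F g) ->
  \int[haar]_g F (g : G)^-1%g = \int[haar]_g F g.
Proof.
move=> mF F0.
have mD : measurable_fun setT
    (fun p : borel G * borel G => F ((p.1 : G)^-1 * (p.2 : G))%g).
  apply: (measurableT_comp mF (g := fun p : borel G * borel G =>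
    ((p.1 : G)^-1 * (p.2 : G))%g : borel G)).
  apply: (measurableT_comp measurable_mulg (g := fun p : borel G * borel G =>
    ((p.1 : G)^-1%g : borel G, p.2))).
  apply: measurable_fun_pair => //=.
  exact: (measurableT_comp measurable_invg).
have cstI (c : \bar R) : c = \int[haar]_g c.
  by rewrite integral_cst// [X in _ * X]probability_setT mule1.
transitivity (\int[haar]_h \int[haar]_g F ((h : G)^-1 * (g : G))%g); last first.
  rewrite [RHS]cstI; apply: eq_integral => h _.
  exact: (integral_haar_mulgl _ mF).
rewrite (fubini_tonelli _ mD)// [LHS]cstI; apply: eq_integral => g _.
have mH : measurable_fun setT (fun h : borel G => F ((h : G)^-1 * (g : G))%g).
  exact: measurable_fun_pair1 _ mD.
rewrite -(integral_haar_mulgl g mH)//; apply: eq_integral => h _.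
by rewrite invgM -mulgA mulVg mulg1.
Qed.

(** Inversion exchanges left and right translations. *)
Lemma integral_haar_mulgr (k : G) F :
  measurable_fun setT F -> (forall g, 0 <= F g) ->
  \int[haar]_g F ((g : G) * k)%g = \int[haar]_g F g.
Proof.
move=> mF F0.
have mFk : measurable_fun setT (fun g : borel G => F ((g : G) * k)%g).
  exact: measurableT_comp (measurable_mulgr k).
have mFV : measurable_fun setT (fun g : borel G => F (g : G)^-1%g).
  exact: measurableT_comp measurable_invg.
rewrite -integral_haar_invg// -[RHS]integral_haar_invg//.
rewrite -[RHS](integral_haar_mulgl k^-1%g mFV)//.
by apply: eq_integral => g _; rewrite invgM invgK.
Qed.

End haar.

(** * Orbit means and invariant probabilities *)

Section action.
Context (R : realType) (G : topGroupType) (Y : ptopologicalType).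
Context (haar : probability (borel G) R) (act : G -> Y -> Y).
Hypotheses (G2 : @second_countable G) (Y2 : @second_countable Y).
Hypotheses (haarP : is_haar haar) (actP : continuous_action act).
Implicit Types h f eps : borel Y -> \bar R.
Implicit Types P Q : probability (borel Y) R.

Local Notation om := (orbit_mean haar act).

Lemma measurable_act :
  measurable_fun setT
    ((fun p : G * Y => act p.1 p.2) : borel G * borel Y -> borel Y).
Proof. by case: actP => _ _; exact: measurable_continuous_prod. Qed.

Lemma measurable_actl (g : G) :
  measurable_fun setT (act g : borel Y -> borel Y).
Proof. exact: measurable_fun_pair2 _ measurable_act. Qed.

Lemma measurable_orbit_map (y : Y) :
  measurable_fun setT ((fun g : G => act g y) : borel G -> borel Y).
Proof. exact: measurable_fun_pair1 _ measurable_act. Qed.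

Lemma image_actV (g : G) (A : set Y) : act g^-1%g @` A = act g @^-1` A.
Proof.
have [act1 actM _] := actP.
apply/seteqP; split => [_ [y Ay <-]|y Agy].
  by rewrite /preimage/= -actM mulgV act1.
by exists (act g y) => //; rewrite -actM mulVg act1.
Qed.

Lemma measurable_comp_act h : measurable_fun setT h ->
  measurable_fun setT (fun p : borel G * borel Y => h (act p.1 p.2)).
Proof. by move=> mh; exact: (measurableT_comp mh measurable_act). Qed.

Lemma measurable_orbit h (y : Y) : measurable_fun setT h ->
  measurable_fun setT (fun g : borel G => h (act g y)).
Proof. by move=> mh; exact: (measurableT_comp mh (measurable_orbit_map y)). Qed.

Lemma orbit_mean_ge0 h y : (forall y, 0 <= h y) -> 0 <= om h y.
Proof. by move=> h0; apply: integral_ge0. Qed.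

Lemma measurable_orbit_mean h : measurable_fun setT h -> (forall y, 0 <= h y) ->
  measurable_fun setT (om h : borel Y -> \bar R).
Proof.
move=> mh h0.
exact: (@measurable_fun_fubini_tonelli_G _ _ _ _ _ haar _
  (measurable_comp_act mh)).
Qed.

Lemma orbit_mean_act h (k : G) (y : Y) :
  measurable_fun setT h -> (forall y, 0 <= h y) -> om h (act k y) = om h y.
Proof.
move=> mh h0; have [_ actM _] := actP.
rewrite -[RHS](integral_haar_mulgr G2 haarP k (measurable_orbit y mh))//.
by apply: eq_integral => g _; rewrite actM.
Qed.

Lemma orbit_mean_comp_act h (k : G) (y : Y) :
  measurable_fun setT h -> (forall y, 0 <= h y) ->
  om (fun y => h (act k y)) y = om h y.
Proof.
move=> mh h0; have [_ actM _] := actP.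
rewrite -[RHS](integral_haar_mulgl G2 haarP k (measurable_orbit y mh))//.
by apply: eq_integral => g _; rewrite actM.
Qed.

Lemma orbit_meanMr h c (y : Y) :
  measurable_fun setT h -> (forall y, 0 <= h y) -> (forall y, 0 <= c y) ->
  (forall g z, c (act g z) = c z) ->
  om (fun y => h y * c y) y = om h y * c y.
Proof.
move=> mh h0 c0 cinv; rewrite -ge0_integralZr//; last exact: measurable_orbit.
by apply: eq_integral => g _; rewrite cinv.
Qed.

Lemma integral_invariant P h (k : G) :
  group_invariant act P -> measurable_fun setT h -> (forall y, 0 <= h y) ->
  \int[P]_y h (act k y) = \int[P]_y h y.
Proof.
move=> invP mh h0.
have [P' [P'E P'int]] := law_probability P (measurable_actl k).
rewrite -P'int//; apply: eq_measure_integral => A mA _.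
by rewrite [LHS]P'E -image_actV; exact: invP.
Qed.

(** By invariance of [P], the integral of [h (g y)] over [y] does not depend on
    [g]; averaging over [g] and exchanging the integrals gives the orbit mean.
*)
Lemma integral_orbit_mean P h :
  group_invariant act P -> measurable_fun setT h -> (forall y, 0 <= h y) ->
  \int[P]_y h y = \int[P]_y om h y.
Proof.
move=> invP mh h0.
rewrite /orbit_mean.
rewrite -(fubini_tonelli (m1 := haar) (m2 := P) _ (measurable_comp_act mh))//.
rewrite -[LHS]mule1 -[X in _ * X](probability_setT haar) -integral_cst//.
by apply: eq_integral => g _; rewrite (integral_invariant g invP mh).
Qed.

(** The law of [g y] under the Haar probability: its invariance is the left
    invariance of the Haar probability. *)
Lemma orbit_law (y : Y) : exists P, group_invariant act P /\
  (forall h, measurable_fun setT h -> (forall y, 0 <= h y) ->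
    \int[P]_z h z = om h y).
Proof.
have [P [PE Pint]] := law_probability haar (measurable_orbit_map y).
exists P; split => // k A mA.
have mkA : measurable (act k @^-1` A : set (borel Y)).
  by rewrite -[X in measurable X]setTI; exact: measurable_actl.
rewrite image_actV -[LHS]integral_indicT// -[RHS]integral_indicT//.
have mI := measurable_eindic (R := R) mA.
rewrite !Pint//; last exact: measurable_eindic.
exact: orbit_mean_comp_act mI _.
Qed.

(** The group average is the law of [g y] for independent [g] and [y], of laws
    [haar] and [Q]; the equality holds on all sets, measurable or not, so that
    it can be rewritten in any statement about the group average. *)
Lemma group_average_probability Q : exists Qbar : probability (borel Y) R,
  [/\ group_average haar act Q = Qbar :> (set (borel Y) -> \bar R),
      group_invariant act Qbar &
      forall h, measurable_fun setT h -> (forall y, 0 <= h y) ->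
        \int[Qbar]_y h y = \int[Q]_y om h y].
Proof.
have prod1 : (haar \x Q) setT = 1.
  by rewrite -setXTT product_measure1E// [X in X * _]probability_setT
    [X in _ * X]probability_setT mule1.
pose prodP : probability (borel G * borel Y)%type R :=
  HB.pack (haar \x Q) (Measure_isProbability.Build _ _ _ (haar \x Q) prod1).
have [Qbar [QbarE Qbarint]] := law_probability prodP measurable_act.
have QbarI h : measurable_fun setT h -> (forall y, 0 <= h y) ->
    \int[Qbar]_y h y = \int[Q]_y om h y.
  move=> mh h0; rewrite Qbarint//.
  rewrite (fubini_tonelli1 _ (measurable_comp_act mh))//.
  exact: (fubini_tonelli (m1 := haar) (m2 := Q) _ (measurable_comp_act mh)).
exists Qbar; split => //.
  apply/funext => A; rewrite QbarE; apply: eq_integral => g _.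
  by rewrite image_actV /= xsectionE.
move=> k A mA.
have mkA : measurable (act k @^-1` A : set (borel Y)).
  by rewrite -[X in measurable X]setTI; exact: measurable_actl.
rewrite image_actV -[LHS]integral_indicT// -[RHS]integral_indicT//.
have mI := measurable_eindic (R := R) mA.
rewrite !QbarI//; last exact: measurable_eindic.
by apply: eq_integral => y _; exact: orbit_mean_comp_act mI _.
Qed.

(** Validity is tested on the orbit laws alone, because every invariant
    probability is a mixture of them. *)
Lemma valid_evalueP eps : measurable_fun setT eps -> (forall y, 0 <= eps y) ->
  valid_evalue act eps <-> (forall y, om eps y <= 1).
Proof.
move=> meps eps0; split => [[_ _ epsP] y|eps1].
  by have [P [invP Pint]] := orbit_law y; rewrite -Pint//; exact: epsP.
split => // P invP; rewrite (integral_orbit_mean invP)//.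
apply: (@le_trans _ _ (\int[P]_y cst 1 y)); last first.
  by rewrite integral_cst// mul1e [leLHS]probability_setT.
by apply: ge0_le_integral => // [y _|]; [exact: orbit_mean_ge0|
  exact: measurable_orbit_mean].
Qed.

End action.

(** * Comparing integrals of logarithms *)

Lemma ae_dominated d (T : measurableType d) (R : realType)
    (mu nu : {measure set T -> \bar R}) (P : T -> Prop) :
  mu `<< nu -> {ae nu, forall x, P x} -> {ae mu, forall x, P x}.
Proof.
move=> /null_content_dominatesP munu [A [mA nuA PA]].
by exists A; split => //; exact: munu.
Qed.

(** If the ratio [e' / e] has mean at most 1, [lne e'] has no larger integral
    than [lne e]. Integrating [lne_tangent] compares the positive and negative
    parts of both logarithms; the finite mass of [mu] cancels, and definedness of the
    two integrals excludes the cases where the parts cannot be recombined. *)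
Lemma le_log_integral d (T : measurableType d) (R : realType)
    (mu : {measure set T -> \bar R}) (e e' : T -> \bar R) :
  mu setT < +oo ->
  measurable_fun setT e -> {ae mu, forall x, 0 < e x < +oo} ->
  (forall x, 0 <= e x) ->
  measurable_fun setT e' -> (forall x, 0 <= e' x) ->
  \int[mu]_x (e' x / e x) <= mu setT ->
  (\int[mu]_x (@lne R \o e)^\+ x) +? (- \int[mu]_x (@lne R \o e)^\- x) ->
  (\int[mu]_x (@lne R \o e')^\+ x) +? (- \int[mu]_x (@lne R \o e')^\- x) ->
  \int[mu]_x lne (e' x) <= \int[mu]_x lne (e x).
Proof.
move=> muoo me eoo e0 me' e'0 ratio1.
have mL (g : T -> \bar R) : measurable_fun setT g ->
    measurable_fun setT (@lne R \o g).
  by move=> mg; apply: measurableT_comp mg; exact: measurable_lne.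
have mp (g : T -> \bar R) : measurable_fun setT g ->
    measurable_fun setT (@lne R \o g)^\+.
  by move=> mg; apply: measurable_funepos; exact: mL.
have mn (g : T -> \bar R) : measurable_fun setT g ->
    measurable_fun setT (@lne R \o g)^\-.
  by move=> mg; apply: measurable_funeneg; exact: mL.
have mr : measurable_fun setT (fun x => e' x / e x).
  apply: emeasurable_funM => //; apply: measurableT_comp me.
  exact: measurable_inve.
have r0 x : 0 <= e' x / e x by rewrite mule_ge0// inve_ge0.
rewrite [X in _ -> _ -> X <= _]integralE [X in _ -> _ -> _ <= X]integralE.
rewrite -!/((@lne R \o _)^\+) -!/((@lne R \o _)^\-).
set A := \int[mu]_x (@lne R \o e)^\+ x.
set B := \int[mu]_x (@lne R \o e)^\- x.
set A' := \int[mu]_x (@lne R \o e')^\+ x.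
set B' := \int[mu]_x (@lne R \o e')^\- x.
have A0 : 0 <= A by apply: integral_ge0.
have B0 : 0 <= B by apply: integral_ge0.
have A'0 : 0 <= A' by apply: integral_ge0.
have B'0 : 0 <= B' by apply: integral_ge0.
have : A' + B <= A + B'.
  have mufin : mu setT \is a fin_num by rewrite ge0_fin_numE.
  rewrite -(leeD2rE _ _ mufin).
  apply: (@le_trans _ _ (A + B' + \int[mu]_x (e' x / e x))); last exact: leeD.
  rewrite -[mu setT]mul1e -(integral_cst mu measurableT 1).
  have mD (g h : T -> \bar R) :
      measurable_fun setT g -> measurable_fun setT h ->
      measurable_fun setT (fun x => (@lne R \o g)^\+ x + (@lne R \o h)^\- x).
    by move=> mg mh; apply: emeasurable_funD; [exact: mp|exact: mn].
  rewrite -!ge0_integralD//; do ?[exact: mp|exact: mn|exact: mD|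
    by move=> x _; rewrite adde_ge0].
  apply: ae_ge0_le_integral => //.
  - by move=> x _; rewrite !adde_ge0.
  - by apply: emeasurable_funD => //; exact: mD.
  - by move=> x _; rewrite !adde_ge0.
  - by apply: emeasurable_funD => //; exact: mD.
  apply: filterS eoo => x ex _; have := lne_tangent (e'0 x) ex.
  by rewrite !funeposE !funenegE.
move: A0 B0 A'0 B'0; move: A B A' B' => [a| |] [b| |] [a'| |] [b'| |]//.
all: rewrite ?oppey ?addeNy ?addNye ?leNye//.
all: rewrite -?EFinN -?EFinD ?addye ?addey ?leey//.
all: rewrite ?lee_fin => _ _ _ _.
all: lra.
Qed.

(** * The logarithmic e-value *)

Section evalue.
Context (R : realType) (G : topGroupType) (Y : ptopologicalType).
Context (haar : probability (borel G) R) (act : G -> Y -> Y).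
Hypotheses (G2 : @second_countable G) (Y2 : @second_countable Y).
Hypotheses (haarP : is_haar haar) (actP : continuous_action act).
Context (Q Qbar : probability (borel Y) R).
Context (Qa Qs : {measure set (borel Y) -> \bar R}).
Hypothesis QE : forall A : set (borel Y), measurable A -> Q A = Qa A + Qs A.
Hypothesis QbarI : group_invariant act Qbar.

Local Notation om := (orbit_mean haar act).

(** The set is the trace of [B], a Qbar-null carrier of [Qs], on the orbits that
    meet [B] in a Haar-null set of group elements. *)
Lemma infinity_set_exists :
  (forall h : borel Y -> \bar R,
    measurable_fun setT h -> (forall y, 0 <= h y) ->
    \int[Qbar]_y h y = \int[Q]_y om h y) ->
  singular Qs Qbar -> exists N, infinity_set act Qs N.
Proof.
move=> Qbarint [B [mB QsB QbarB]].
pose I (A : set (borel Y)) (y : borel Y) : \bar R := (\1_A y)%:E.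
have mI A : measurable A -> measurable_fun setT (I A).
  exact: measurable_eindic.
have I0 A y : 0 <= I A y by rewrite lee_fin.
have momI : measurable_fun setT (om (I B) : borel Y -> \bar R).
  exact: (measurable_orbit_mean _ G2 Y2 actP (mI _ mB)).
(* The orbits that meet B in a set of positive Haar measure. *)
pose C : set (borel Y) := [set y | om (I B) y != 0].
have mC : measurable C by rewrite -[C]setTI; exact: emeasurable_neq.
have QC : Q C = 0.
  have : \int[Q]_y `|om (I B) y| = 0.
    under eq_integral do rewrite gee0_abs ?orbit_mean_ge0//.
    rewrite -Qbarint//; last exact: mI.
    by rewrite integral_indicT.
  move/(ae_eq_integral_abs _ measurableT momI) => [D [mD QD CD]].
  apply/eqP; rewrite -measure_le0 -QD le_measure ?inE// => y Cy.
  by apply: CD => /(_ Logic.I) /eqP; apply/negP.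
exists (B `&` ~` C); split.
- by apply: measurableI => //; exact: measurableC.
- rewrite setCI setCK; apply/eqP; rewrite -measure_le0.
  apply: (le_trans (measureU2 Qs (measurableC mB) mC)).
  by rewrite [X in X + _]QsB add0e -QC (QE mC) leeDr.
- move=> P invP.
  have mN : measurable (B `&` ~` C).
    by apply: measurableI => //; exact: measurableC.
  rewrite -integral_indicT//.
  rewrite (integral_orbit_mean haar G2 Y2 actP invP (mI _ mN))//.
  apply: integral0_eq => y _; apply/eqP.
  (* Either the orbit of y meets B in a null set, or it lies in C. *)
  have [omy|omy] := eqVneq (om (I B) y) 0.
    rewrite eq_le orbit_mean_ge0// andbT -omy.
    apply: ge0_le_integral => //.
    - exact: measurable_orbit (mI _ mN).
    - exact: measurable_orbit (mI _ mB).
    - move=> g _; rewrite lee_fin !indicE in_setI ler_nat.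
      by case: (_ \in B); rewrite //= leq_b1.
  apply/eqP/integral0_eq => g _; rewrite /I indicE memNset// => -[_]; apply.
  by rewrite /C/= (orbit_mean_act G2 Y2 haarP actP _ _ (mI _ mB)).
Qed.

Context (f : borel Y -> \bar R).
Hypotheses (mf : measurable_fun setT f) (f0 : forall y, 0 <= f y).

Let mom : measurable_fun setT (om f : borel Y -> \bar R).
Proof. exact: measurable_orbit_mean. Qed.

Let om0 y : 0 <= om f y. Proof. exact: orbit_mean_ge0. Qed.

Let om_act k y : om f (act k y) = om f y.
Proof. exact: orbit_mean_act. Qed.

Lemma measurable_log_evalue (N : set (borel Y)) : measurable N ->
  measurable_fun setT (log_evalue haar act f N).
Proof.
move=> mN; apply: measurable_fun_ifT => //=.
  apply: (measurable_fun_bool true); rewrite setTI.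
  rewrite (_ : _ @^-1` _ = N)//.
  by apply/seteqP; split => y /= => [/set_mem|]; last exact: mem_set.
apply: measurable_fun_ifT => //=.
  by apply: measurable_fun_lte.
apply: emeasurable_funM => //; apply: measurableT_comp mom.
exact: measurable_inve.
Qed.

Lemma log_evalue_ge0 (N : set (borel Y)) y : 0 <= log_evalue haar act f N y.
Proof.
rewrite /log_evalue; case: ifP => // _; case: ifP => // _.
by rewrite mule_ge0// inve_ge0.
Qed.

(** On an orbit, [om f] is a constant, so [f / om f] averages to 1 if it is
    positive and finite, and to 0 if it is infinite. *)
Lemma valid_log_evalue_set0 : valid_evalue act (log_evalue haar act f set0).
Proof.
apply/(valid_evalueP G2 Y2 haarP actP).
- exact: measurable_log_evalue.
- exact: log_evalue_ge0.
move=> y; rewrite [leLHS](eq_integral (fun g : borel G =>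
  if 0 < om f y then f (act g y) / om f y else 1)); last first.
  by move=> g _; rewrite /log_evalue in_set0 om_act.
have [omy|_] := boolP (0 < om f y); last first.
  by rewrite integral_cst// mul1e [leLHS]probability_setT.
rewrite ge0_integralZr//; [|exact: measurable_orbit mf|by rewrite inve_ge0].
have [->|omoo] := eqVneq (om f y) +oo; first by rewrite invey mule0.
by rewrite -/(om f y) divee ?gt_eqF// ge0_fin_numE// lt_neqAle omoo leey.
Qed.

(** The value +oo on [N] is invisible to invariant probabilities. *)
Lemma valid_log_evalue (N : set (borel Y)) : infinity_set act Qs N ->
  valid_evalue act (log_evalue haar act f N).
Proof.
move=> [mN _ PN]; have [m0 _ val0] := valid_log_evalue_set0.
split; [exact: measurable_log_evalue|exact: log_evalue_ge0|move=> P invP].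
apply: le_trans (val0 P invP); rewrite le_eqVlt; apply/orP; left; apply/eqP.
apply: ge0_ae_eq_integral => //; [exact: measurable_log_evalue|
  by move=> y _; exact: log_evalue_ge0|by move=> y _; exact: log_evalue_ge0|].
exists N; split => //; first exact: PN.
move=> y /= eps_neq; apply: contrapT => yN; apply: eps_neq => _.
by rewrite /log_evalue in_set0 memNset.
Qed.

Hypothesis QaE : forall A : set (borel Y), measurable A ->
  Qa A = \int[Qbar]_(y in A) f y.
Hypothesis QaQbar : Qa `<< Qbar.

Lemma Qa_lty : Qa setT < +oo.
Proof.
apply: (@le_lt_trans _ _ (Q setT)); last first.
  by rewrite [ltLHS]probability_setT ltry.
by rewrite [leRHS]QE// leeDl.
Qed.

Lemma integral_Qa h : measurable_fun setT h -> (forall y, 0 <= h y) ->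
  \int[Qa]_y h y = \int[Qbar]_y (h y * f y).
Proof. by move=> mh h0; exact: ge0_integral_density Qa_lty _ _ _ _ _. Qed.

Lemma integral_orbit_mean_density : \int[Qbar]_y om f y = Qa setT.
Proof. by rewrite QaE// [RHS](integral_orbit_mean haar G2 Y2 actP QbarI). Qed.

(** Qbar-almost every point avoids the degenerate cases of the quotient
    [f / om f]. In particular [f] vanishes a.e. where [om f] does: the integral
    of [f] over the union of the orbits with [om f = 0] is that of its orbit mean,
    which is 0. *)
Lemma ae_regular (N : set (borel Y)) : infinity_set act Qs N ->
  {ae Qbar, forall y, [/\ y \notin N, f y < +oo, om f y < +oo &
    om f y = 0 -> f y = 0]}.
Proof.
move=> [mN _ PN].
have fin_ae (h : borel Y -> \bar R) : measurable_fun setT h ->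
    (forall y, 0 <= h y) -> \int[Qbar]_y h y < +oo ->
    {ae Qbar, forall y, h y < +oo}.
  move=> mh h0 hoo; have ih : Qbar.-integrable setT h.
    by apply/integrableP; split => //; under eq_integral do rewrite gee0_abs//.
  apply: filterS (integrable_ae measurableT ih) => y /(_ Logic.I).
  by rewrite ge0_fin_numE.
have aeN : {ae Qbar, forall y, y \notin N}.
  exists N; split => //; first exact: PN.
  by move=> y /= /negP; rewrite negbK inE.
have aef : {ae Qbar, forall y, f y < +oo}.
  by apply: fin_ae => //; rewrite -QaE// Qa_lty.
have aeom : {ae Qbar, forall y, om f y < +oo}.
  by apply: fin_ae => //; rewrite integral_orbit_mean_density Qa_lty.
have ae0 : {ae Qbar, forall y, om f y = 0 -> f y = 0}.
  pose Z : set (borel Y) := [set y | om f y = 0].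
  have mZ : measurable Z.
    by rewrite -[Z]setTI; exact: (mom measurableT (emeasurable_set1 0)).
  have mI := measurable_eindic (R := R) mZ.
  have mfI : measurable_fun setT (fun y => f y * (\1_Z y)%:E).
    exact: emeasurable_funM.
  have fI0 y : 0 <= f y * (\1_Z y)%:E by rewrite mule_ge0// lee_fin.
  have : \int[Qbar]_y `|f y * (\1_Z y)%:E| = 0.
    under eq_integral do rewrite gee0_abs//.
    rewrite (integral_orbit_mean haar G2 Y2 actP QbarI mfI)//.
    apply: integral0_eq => y _.
    rewrite (orbit_meanMr haar G2 Y2 actP)//; last first.
      move=> g z; rewrite !indicE; suff -> : (act g z \in Z) = (z \in Z) by [].
      by apply/idP/idP; rewrite !inE /Z /= om_act.
    have [Zy|Zy] := pselect (Z y); first by rewrite Zy mul0e.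
    by rewrite indicE memNset// mule0.
  move/(ae_eq_integral_abs _ measurableT mfI).
  apply: filterS => y /(_ Logic.I) + Zy.
  by rewrite indicE mem_set// mule1.
have FQ : Filter (nbhs (almost_everywhere Qbar)) :=
  ae_filter_ringOfSetsType Qbar.
by apply: filterS (filterI (filterI aeN aef) (filterI aeom ae0)) =>
  y [[? ?] [? ?]].
Qed.

(** [Qa] gives no mass to [f = 0], hence none to [om f = 0]. *)
Lemma ae_log_evalue_fin (N : set (borel Y)) : infinity_set act Qs N ->
  {ae Qa, forall y, 0 < log_evalue haar act f N y < +oo}.
Proof.
move=> infN.
have aef0 : {ae Qa, forall y, 0 < f y}.
  pose Z : set (borel Y) := [set y | f y = 0].
  have mZ : measurable Z.
    by rewrite -[Z]setTI; exact: (mf measurableT (emeasurable_set1 0)).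
  exists Z; split => //; last first.
    by move=> y /= /negP; rewrite lt0e f0 andbT negbK => /eqP.
  by rewrite [LHS]QaE//; exact: integral0_eq.
apply: filterS2 aef0 (ae_dominated QaQbar (ae_regular infN)) =>
  y fy [yN foo omoo om_f].
have omy : 0 < om f y.
  by rewrite lt0e om0 andbT; apply/eqP => /om_f fy0; rewrite fy0 ltxx in fy.
rewrite /log_evalue (negbTE yN) omy.
move: fy foo omy omoo; move: (f y) (om f y) => [a| |]// [b| |]// a0 _ b0 _.
by rewrite inver gt_eqF// -EFinM ltry lte_fin divr_gt0.
Qed.

(** The density of [Qa] turns [e' / e] into at most [e' * om f], whose orbit
    mean is [om e' * om f <= om f]. *)
Lemma integral_ratio (N : set (borel Y)) (eps' : borel Y -> \bar R) :
  infinity_set act Qs N -> valid_evalue act eps' ->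
  \int[Qa]_y (eps' y / log_evalue haar act f N y) <= Qa setT.
Proof.
move=> infN val'; have [meps' eps'0 _] := val'.
have mN : measurable N by case: infN.
have mr : measurable_fun setT
    (fun y : borel Y => eps' y / log_evalue haar act f N y).
  apply: emeasurable_funM => //.
  by apply: measurableT_comp (measurable_log_evalue mN); exact: measurable_inve.
have r0 y : 0 <= eps' y / log_evalue haar act f N y.
  by rewrite mule_ge0// inve_ge0 log_evalue_ge0.
rewrite integral_Qa//.
apply: (@le_trans _ _ (\int[Qbar]_y (eps' y * om f y))).
  apply: ae_ge0_le_integral => //.
  - by move=> y _; rewrite mule_ge0.
  - exact: emeasurable_funM.
  - by move=> y _; rewrite mule_ge0.
  - exact: emeasurable_funM.
  apply: filterS (ae_regular infN) => y [yN foo omoo om_f] _.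
  rewrite /log_evalue (negbTE yN); case: ifPn => [omy|]; last first.
    by rewrite lt0e om0 andbT negbK => /eqP /om_f ->; rewrite mule0 mule_ge0.
  have [->|fn0] := eqVneq (f y) 0; first by rewrite mule0 mule_ge0.
  have fy : 0 < f y by rewrite lt0e fn0 f0.
  rewrite le_eqVlt -muleA; apply/orP; left; apply/eqP; congr (_ * _).
  move: fy foo omy omoo; move: (f y) (om f y) => [a| |]// [b| |]// a0 _ b0 _.
  rewrite !lte_fin in a0 b0.
  rewrite inver gt_eqF// -EFinM inver gt_eqF ?divr_gt0// -EFinM; congr (_%:E).
  by rewrite invf_div divfK// gt_eqF.
have meo : measurable_fun setT (fun y => eps' y * om f y).
  exact: emeasurable_funM.
rewrite (integral_orbit_mean haar G2 Y2 actP QbarI meo)//; last first.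
  by move=> y; rewrite mule_ge0.
rewrite -integral_orbit_mean_density; apply: ge0_le_integral => //.
- by move=> y _; apply: orbit_mean_ge0 => z; rewrite mule_ge0.
- by apply: measurable_orbit_mean => // z; rewrite mule_ge0.
move=> y _; rewrite (orbit_meanMr haar G2 Y2 actP)//.
rewrite -[leRHS]mul1e lee_wpmul2r//.
exact: (valid_evalueP G2 Y2 haarP actP meps' eps'0).1.
Qed.

Lemma utility_optimal_log_evalue (N : set (borel Y)) : infinity_set act Qs N ->
  utility_optimal act (@lne R) Qa Qs (log_evalue haar act f N).
Proof.
move=> infN; have [mN QsN PN] := infN.
split; first exact: valid_log_evalue.
  exists (~` N); split => //; first exact: measurableC.
  by move=> y /=; apply: contra_not => yN; rewrite /log_evalue mem_set.
move=> eps' val' def def'; have [meps' eps'0 _] := val'.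
apply: le_log_integral def def' => //.
- exact: Qa_lty.
- exact: measurable_log_evalue.
- exact: ae_log_evalue_fin.
- exact: log_evalue_ge0.
- exact: integral_ratio.
Qed.

End evalue.

Theorem corollary3 (R : realType) (G : topGroupType) (Y : ptopologicalType)
    (HG : second_countable_lch G) (HGcompact : compact [set: G])
    (HY : second_countable_lch Y)
    (act : G -> Y -> Y) (Hact : continuous_action act)
    (haar : probability (borel G) R) (Hhaar : is_haar haar)
    (Q : probability (borel Y) R)
    (Qa Qs : {measure set (borel Y) -> \bar R})
    (HQ : lebesgue_decomposition Q Qa Qs (group_average haar act Q))
    (f : borel Y -> \bar R)
    (Hf : is_RN_derivative Qa (group_average haar act Q) f) :
  (exists N : set (borel Y), infinity_set act Qs N) /\
  (forall N : set (borel Y), infinity_set act Qs N ->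
     utility_optimal act (@lne R) Qa Qs (log_evalue haar act f N)).
Proof.
have [G2 _ _] := HG; have [Y2 _ _] := HY.
have [Qbar [avgE QbarI Qbarint]] :=
  group_average_probability G2 Y2 Hhaar Hact Q.
move: HQ Hf; rewrite avgE => -[QE QaQbar QsQbar] [mf f0 QaE]; split.
  exact: (infinity_set_exists G2 Y2 Hhaar Hact QE Qbarint QsQbar).
exact: (utility_optimal_log_evalue G2 Y2 Hhaar Hact QE QbarI).
Qed.
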